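(* Let $\theta\in\Theta_n$, let $k_n$ be a nonnegative integer, and suppose $P_\theta\Pi_n(B_{k_n}(\theta)\mid X^n)\ge1-x_n$, where $0<x_n<1$. Let $\gamma_n\in(0,1)$ and let $D_n(X^n)$ be a $1-\gamma_n$ credible set, with $k_n$-enlargement $C_n(X^n)$. Then $$P_\theta(\theta\in C_n(X^n))\ge1-\frac1{1-\gamma_n}x_n.$$
   Context: Parameter space: for an integer $0\le m<n/2$, $\Theta_{n,m}=\{\theta\in\{0,1\}^n:\sum_{i=1}^n\theta_i=m\}$; if $n$ is even, $\Theta_{n,n/2}=\{\theta\in\{0,1\}^n:\sum_{i=1}^n\theta_i=n/2,\ \theta_1=0\}$; and $\Theta_n=\bigcup_{m=0}^{\lfloor n/2\rfloor}\Theta_{n,m}$. For $\theta,\eta\in\Theta_n$, $k(\theta,\eta)=\#\{i:\theta_i\ne\eta_i\}$, and $B_{k_n}(\theta)=\{\eta\in\Theta_n:\min\{k(\theta,\eta),n-k(\theta,\eta)\}<k_n\}$. Model (planted bi-section model): $p_n,q_n\in(0,1)$. $X^n$ is a random undirected graph without loops on vertex set $\{1,\ldots,n\}$, with values in the finite set $\mathscr X_n$ of such graphs and edge indicators $X_{ij}\in\{0,1\}$, $i<j$. Under $P_\theta$, $\theta\in\Theta_n$, the $X_{ij}$ ($i<j$) are independent with $P_\theta(X_{ij}=1)=Q_{i,j}(\theta)$, where $Q_{i,j}(\theta)=p_n$ if $\theta_i=\theta_j$ and $Q_{i,j}(\theta)=q_n$ if $\theta_i\ne\theta_j$. The likelihood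 is $p_\theta(X^n)=\prod_{i<j}Q_{i,j}(\theta)^{X_{ij}}(1-Q_{i,j}(\theta))^{1-X_{ij}}$. Posterior: the prior is a probability mass function $\pi_n$ on $\Theta_n$ with $\pi_n(\eta)>0$ for all $\eta\in\Theta_n$, and for $S\subseteq\Theta_n$, $\Pi_n(S\mid X^n)=\sum_{\theta\in S}\pi_n(\theta)p_\theta(X^n)\big/\sum_{\theta\in\Theta_n}\pi_n(\theta)p_\theta(X^n)$. For a real-valued function $f$ of $X^n$, $P_\theta f(X^n)$ denotes its expectation when $X^n\sim P_\theta$. A credible set of credible level $1-\gamma_n$ is a set-valued map $x^n\mapsto D_n(x^n)\subseteq\Theta_n$ with $\Pi_n(D_n(x^n)\mid x^n)\ge1-\gamma_n$ for every $x^n\in\mathscr X_n$. For a nonnegative integer $k_n$, the $k_n$-enlargement of $D_n(X^n)$ is $$C_n(X^n)=\{\theta\in\Theta_n:\exists\,\eta\in D_n(X^n),\ \min\{k(\theta,\eta),n-k(\theta,\eta)\}<k_n\}.$$ *)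

(* Defs.v *)
From HB Require Import structures.
From mathcomp Require Import all_boot all_order all_algebra.
From mathcomp Require Import reals.

Set Implicit Arguments.
Unset Strict Implicit.
Unset Printing Implicit Defensive.

Import Order.TTheory GRing.Theory Num.Theory.
Local Open Scope ring_scope.

(* Vertices are numbered 0, ..., n-1. *)
Notation assignment n := {ffun 'I_n -> bool}.

(* When m = n/2, theta and its complement describe the same bi-section; the
   first vertex is required to be labelled 0 to pick one of them. The classes
   with m > n/2 are not part of the model (last branch). *)
Definition Theta_class (n m : nat) : {set assignment n} :=
  if (m.*2 < n)%N then [set theta : assignment n | (\sum_(i < n) theta i)%N == m]
  else if m.*2 == n then
    [set theta : assignment n | ((\sum_(i < n) theta i)%N == m)
       && [forall i : 'I_n, (i == 0%N :> nat) ==> (theta i == false)]]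
  else set0.

Definition Theta (n : nat) : {set assignment n} :=
  \bigcup_(m < n./2.+1) Theta_class n m.

Definition kdist (n : nat) (theta eta : assignment n) : nat :=
  #|[set i : 'I_n | theta i != eta i]|.

Definition near_class (n : nat) (k : nat) (theta eta : assignment n) : bool :=
  (minn (kdist theta eta) (n - kdist theta eta) < k)%N.

Definition Bset (n : nat) (k : nat) (theta : assignment n) :
  {set assignment n} := [set eta in Theta n | near_class k theta eta].

Definition enlargement (n : nat) (k : nat) (D : {set assignment n}) :
  {set assignment n} :=
  [set theta in Theta n | [exists eta in D, near_class k theta eta]].

Definition is_graph (n : nat) (x : {ffun 'I_n * 'I_n -> bool}) : bool :=
  [forall i, forall j, x (i, j) == x (j, i)] && [forall i, ~~ x (i, i)].

Notation graph n := {x : {ffun 'I_n * 'I_n -> bool} | is_graph x}.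

Definition edge (n : nat) (x : graph n) (i j : 'I_n) : bool := val x (i, j).

Definition Q (R : realType) (n : nat) (p q : R) (theta : assignment n)
  (i j : 'I_n) : R := if theta i == theta j then p else q.

Definition likelihood (R : realType) (n : nat) (p q : R)
    (theta : assignment n) (x : graph n) : R :=
  \prod_(i < n) \prod_(j < n | (i < j)%N)
    (Q p q theta i j ^+ edge x i j
     * (1 - Q p q theta i j) ^+ (1 - edge x i j)%N).

(* The law under which the edge indicators with i < j are independent
   Bernoulli(Q_ij(theta)) is the one whose mass function on the finite set of
   graphs is the likelihood. *)
Definition expect (R : realType) (n : nat) (p q : R) (theta : assignment n)
  (f : graph n -> R) : R := \sum_(x : graph n) likelihood p q theta x * f x.

Definition prob (R : realType) (n : nat) (p q : R) (theta : assignment n)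
  (A : {set graph n}) : R := \sum_(x in A) likelihood p q theta x.

(* A mass function on Theta n; the values of pi outside Theta n are irrelevant. *)
Definition positive_prior (R : realType) (n : nat) (pi : assignment n -> R) :
    Prop :=
  (forall eta, eta \in Theta n -> 0 < pi eta)
  /\ \sum_(eta in Theta n) pi eta = 1.

Definition posterior (R : realType) (n : nat) (p q : R)
    (pi : assignment n -> R) (S : {set assignment n}) (x : graph n) : R :=
  (\sum_(theta in S) pi theta * likelihood p q theta x)
  / (\sum_(theta in Theta n) pi theta * likelihood p q theta x).

Definition credible_set (R : realType) (n : nat) (p q : R)
    (pi : assignment n -> R) (level : R)
    (D : graph n -> {set assignment n}) : Prop :=
  forall x : graph n,
    D x \subset Theta n /\ level <= posterior p q pi (D x) x.

(* Main.v *)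
Require Import Defs.
From mathcomp Require Import all_boot all_order all_algebra.
From mathcomp Require Import reals lra.

(** When [theta] lies outside the enlargement of [D x], no element of [D x] is
    near [theta], so [D x] and the ball around [theta] are disjoint. As [D x]
    has posterior mass at least [1 - gamma], the ball then has posterior mass at
    most [gamma] ([posterior_Bset_uncovered]); where [theta] is covered, the
    mass of the ball is at most 1. If [c] is the probability of coverage,
    averaging over the graph gives
    [1 - xn <= c + (1 - c) * gamma], which rearranges to the claim.

    The average uses that the likelihood is a probability mass function on
    graphs ([sum_likelihood]). A graph amounts to a free choice of a boolean for
    each pair [i < j], so a sum over graphs of a product over such pairs
    factorizes into a product of two-term sums ([sum_graph_prod]). *)

Import Order.TTheory GRing.Theory Num.Theory.
Local Open Scope ring_scope.

Definition upper_part n (x : graph n) : {ffun 'I_n * 'I_n -> bool} :=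
  [ffun ij : 'I_n * 'I_n => (ij.1 < ij.2)%N && edge x ij.1 ij.2].

Definition symmetrized n (f : {ffun 'I_n * 'I_n -> bool}) :
    {ffun 'I_n * 'I_n -> bool} :=
  [ffun ij : 'I_n * 'I_n => ((ij.1 < ij.2)%N && f ij)
              || ((ij.2 < ij.1)%N && f (ij.2, ij.1))].

Lemma symmetrized_is_graph n (f : {ffun 'I_n * 'I_n -> bool}) :
  is_graph (symmetrized n f).
Proof.
apply/andP; split.
  by apply/forallP=> i; apply/forallP=> j; rewrite !ffunE /= orbC.
by apply/forallP=> i; rewrite !ffunE /= ltnn.
Qed.

Definition symmetric_graph n (f : {ffun 'I_n * 'I_n -> bool}) : graph n :=
  exist (fun g => is_graph g) (symmetrized n f) (symmetrized_is_graph n f).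

Lemma upper_part_symmetric_graph n (f : {ffun 'I_n * 'I_n -> bool}) :
  (forall i j, f (i, j) -> (i < j)%N) ->
  upper_part n (symmetric_graph n f) = f.
Proof.
move=> f_upper; apply/ffunP=> -[i j]; rewrite !ffunE /edge /= ffunE /=.
case: ltngtP => //= ij; rewrite ?orbF //; apply/esym/negP => /f_upper.
  by rewrite ltnNge (ltnW ij).
by rewrite ij ltnn.
Qed.

Lemma symmetric_graph_upper_part n (x : graph n) :
  symmetric_graph n (upper_part n x) = x.
Proof.
apply/val_inj/ffunP=> -[i j] /=; rewrite !ffunE /= /edge.
have /andP[/forallP x_sym /forallP x_irr] := valP x.
have /forallP/(_ j)/eqP xij := x_sym i.
case: (ltngtP i j) => [ij|ji|/val_inj <-] /=; rewrite ?orbF //.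
by apply/esym/negbTE/x_irr.
Qed.

(** Distributing a product of sums produces all boolean functions on ordered
    pairs, not only graphs. Giving the pairs with [j <= i] weight 1 at [false]
    and 0 at [true] leaves the right-hand side unchanged and kills every
    function but the upper parts of graphs, each of which occurs once. *)
Lemma sum_graph_prod (R : comPzRingType) n (w : 'I_n -> 'I_n -> bool -> R) :
  \sum_(x : graph n) \prod_(i < n) \prod_(j < n | (i < j)%N) w i j (edge x i j)
  = \prod_(i < n) \prod_(j < n | (i < j)%N) (w i j true + w i j false).
Proof.
pose W (ij : 'I_n * 'I_n) b : R :=
  if (ij.1 < ij.2)%N then w ij.1 ij.2 b else (~~ b)%:R.
have prodW (b : 'I_n -> 'I_n -> bool) :
    \prod_(i < n) \prod_(j < n | (i < j)%N) w i j (b i j)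
    = \prod_(ij : 'I_n * 'I_n) W ij ((ij.1 < ij.2)%N && b ij.1 ij.2).
  rewrite pair_big_dep big_mkcond; apply: eq_bigr => -[i j] _ /=.
  by rewrite /W /=; case: ifP.
transitivity (\prod_(ij : 'I_n * 'I_n) \sum_(b : bool) W ij b); last first.
  rewrite [RHS]pair_big_dep [RHS]big_mkcond; apply: eq_bigr => -[i j] _ /=.
  rewrite big_bool /W /=; case: ifP => // _; exact: add0r.
rewrite bigA_distr_bigA /=.
pose upper (f : {ffun 'I_n * 'I_n -> bool}) :=
  [forall ij, f ij ==> (ij.1 < ij.2)%N].
rewrite (bigID upper) /= [X in _ + X]big1 ?addr0; last first.
  move=> f /forallPn[ij]; rewrite negb_imply => /andP[fij /negbTE not_lt].
  by rewrite (bigD1 ij) //= {1}/W not_lt fij mul0r.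
rewrite (reindex (upper_part n)) /=.
  apply: eq_big => [x|x _].
    by apply/esym/forallP=> ij; rewrite ffunE; apply/implyP => /andP[].
  by rewrite prodW; apply: eq_bigr => ij _; rewrite ffunE.
exists (symmetric_graph n) => [x _|f].
  exact: symmetric_graph_upper_part.
rewrite inE => /forallP f_upper; apply: upper_part_symmetric_graph => i j fij.
exact: (implyP (f_upper (i, j))).
Qed.

Lemma sum_likelihood (R : realType) n (p q : R) theta :
  \sum_(x : graph n) likelihood p q theta x = 1.
Proof.
pose w i j (b : bool) : R :=
  Q p q theta i j ^+ b * (1 - Q p q theta i j) ^+ (1 - b)%N.
rewrite (sum_graph_prod _ _ w) big1 // => i _; rewrite big1 // => j _.
by rewrite /w /= !expr0 !expr1 mulr1 mul1r addrC subrK.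
Qed.

Lemma likelihood_gt0 (R : realType) n (p q : R) theta (x : graph n) :
  0 < p < 1 -> 0 < q < 1 -> 0 < likelihood p q theta x.
Proof.
move=> hp hq; apply: prodr_gt0 => i _; apply: prodr_gt0 => j _.
have /andP[Q_gt0 Q_lt1] : 0 < Q p q theta i j < 1 by rewrite /Q; case: ifP.
by rewrite mulr_gt0 ?exprn_gt0 ?subr_gt0.
Qed.

Lemma posterior_disjoint_le1 (R : realType) n (p q : R)
    (pi : {ffun 'I_n -> bool} -> R) (S T : {set {ffun 'I_n -> bool}})
    (x : graph n) :
  0 < p < 1 -> 0 < q < 1 -> positive_prior pi ->
  S \subset Theta n -> T \subset Theta n -> [disjoint S & T] ->
  posterior p q pi S x + posterior p q pi T x <= 1.
Proof.
move=> hp hq [pi_gt0 _] ST TT dST.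
have term_ge0 eta : eta \in Theta n -> 0 <= pi eta * likelihood p q eta x.
  by move=> /pi_gt0 hpi; rewrite mulr_ge0 ?ltW ?likelihood_gt0.
rewrite /posterior -mulrDl -bigU //=.
set N := \sum_(eta in Theta n) _.
have le_N : \sum_(eta in S :|: T) pi eta * likelihood p q eta x <= N.
  rewrite /N [leRHS](big_setID (S :|: T)) /=.
  have /setIidPr -> : S :|: T \subset Theta n by rewrite subUset ST TT.
  by rewrite lerDl sumr_ge0 // => eta /setDP[/term_ge0].
have : 0 <= N by exact: sumr_ge0 term_ge0.
(* A vanishing normalizing constant makes every quotient 0 by convention. *)
rewrite le_eqVlt => /predU1P[<-|N_gt0]; first by rewrite invr0 mulr0 ler01.
rewrite ler_pdivrMr // mul1r.
by rewrite (eq_bigl (mem (S :|: T))) // => eta; rewrite !inE.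
Qed.

Lemma Bset_sub_Theta n k (theta : {ffun 'I_n -> bool}) :
  Bset k theta \subset Theta n.
Proof. by apply/subsetP=> eta; rewrite inE => /andP[]. Qed.

Lemma posterior_Bset_le1 (R : realType) n (p q : R)
    (pi : {ffun 'I_n -> bool} -> R) k theta (x : graph n) :
  0 < p < 1 -> 0 < q < 1 -> positive_prior pi ->
  posterior p q pi (Bset k theta) x <= 1.
Proof.
move=> hp hq hpi.
have := @posterior_disjoint_le1 R n p q pi (Bset k theta) set0 x hp hq hpi.
rewrite {2}/posterior big_set0 mul0r addr0; apply.
- exact: Bset_sub_Theta.
- exact: sub0set.
- by rewrite -setI_eq0 setI0.
Qed.

Lemma disjoint_Bset_uncovered n k (theta : {ffun 'I_n -> bool}) D :
  theta \in Theta n -> theta \notin enlargement k D -> [disjoint Bset k theta & D].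
Proof.
move=> htheta; rewrite inE htheta => /existsPn far.
rewrite disjoint_subset; apply/subsetP=> eta; rewrite !inE => /andP[_ near].
by apply: contra (far eta) => etaD; rewrite etaD near.
Qed.

Lemma posterior_Bset_uncovered (R : realType) n (p q : R)
    (pi : {ffun 'I_n -> bool} -> R) k theta gamma D (x : graph n) :
  0 < p < 1 -> 0 < q < 1 -> positive_prior pi -> theta \in Theta n ->
  credible_set p q pi (1 - gamma) D -> theta \notin enlargement k (D x) ->
  posterior p q pi (Bset k theta) x <= gamma.
Proof.
move=> hp hq hpi htheta hD uncovered; have [DT credible] := hD x.
have := @posterior_disjoint_le1 R n p q pi _ _ x hp hq hpi
  (Bset_sub_Theta n k theta) DT
  (disjoint_Bset_uncovered n k theta _ htheta uncovered).
lra.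
Qed.

Theorem lemma5p3 (R : realType) (n : nat) (p q : R)
  (hp : 0 < p < 1) (hq : 0 < q < 1)
  (pi : {ffun 'I_n -> bool} -> R) (hpi : positive_prior pi)
  (theta : {ffun 'I_n -> bool}) (htheta : theta \in Theta n)
  (k : nat) (xn : R) (hxn : 0 < xn < 1)
  (hB : expect p q theta (fun x => posterior p q pi (Bset k theta) x)
        >= 1 - xn)
  (gamma : R) (hgamma : 0 < gamma < 1)
  (D : graph n -> {set {ffun 'I_n -> bool}})
  (hD : credible_set p q pi (1 - gamma) D) :
  prob p q theta [set x | theta \in enlargement k (D x)]
    >= 1 - 1 / (1 - gamma) * xn.
Proof.
have /andP[_ gamma_lt1] := hgamma.
have gamma'_gt0 : 0 < 1 - gamma by rewrite subr_gt0.
set A := [set x | _]; rewrite /prob; set c := \sum_(x in A) _.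
have mass_uncovered : \sum_(x | x \notin A) likelihood p q theta x = 1 - c.
  rewrite -(sum_likelihood R n p q theta) [in RHS](bigID (mem A)) /= -/c.
  by rewrite addrAC subrr add0r.
have mean_le : expect p q theta (fun x => posterior p q pi (Bset k theta) x)
    <= c + (1 - c) * gamma.
  rewrite /expect (bigID (mem A)) /= -mass_uncovered mulr_suml.
  apply: lerD; apply: ler_sum => x; rewrite inE => covered.
    by rewrite ler_piMr ?posterior_Bset_le1 // ltW ?likelihood_gt0.
  rewrite ler_wpM2l ?(ltW (likelihood_gt0 _ _ _ _ _ _ _ _)) //.
  exact: posterior_Bset_uncovered hD covered.
rewrite div1r mulrC lerBlDr -lerBlDl ler_pdivlMr //.
lra.
Qed.
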